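(* Let $G$ be a graph of order $n$ such that both $G$ and its complement $\overline{G}$ are connected. If $n\notin\{12,13,14,15,16,17,18,20,21,24\}$, then $$\gamma_P(G)+\gamma_P(\overline{G})\le \left\lceil\frac{n}{3}\right\rceil+1,$$ and this bound is attained for arbitrarily large $n\ge 6$ by graphs $G\in\mathcal{T}$.
   Context: All graphs are finite, simple, undirected, with nonempty vertex set; the order is the number of vertices. $N(v)$ is the set of neighbors of $v$, $N[v]=N(v)\cup\{v\}$, and $N[S]=\bigcup_{v\in S}N[v]$. For $S\subseteq V(G)$, define $PD(S)$ by: (1) start with $PD(S):=N[S]$; (2) while there exists $v\in PD(S)$ with $|N(v)\setminus PD(S)|=1$, set $PD(S):=PD(S)\cup N(v)$. $S$ is a power dominating set if $PD(S)=V(G)$ at the end of the process. The power domination number $\gamma_P(G)$ is the minimum cardinality of a power dominating set of $G$. $\mathcal{T}$ is the family of graphs constructed by starting with a connected graph $H$ and, for each $v\in V(H)$, adding two new vertices $v'$ and $v''$, each adjacent to $v$ and possibly to each other but not to any other vertices. *)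

(* Defs.v *)
From HB Require Import structures.
From mathcomp Require Import all_boot all_order all_algebra.
Set Implicit Arguments.
Unset Strict Implicit.
Unset Printing Implicit Defensive.

Record sgraph := SGraph {
  svertex :> finType;
  sedge : rel svertex;
  sedge_sym : symmetric sedge;
  sedge_irrefl : irreflexive sedge;
  sgraph_nonempty : 0 < #|svertex|
}.

Definition sg_connected (G : sgraph) : Prop :=
  forall x y : G, connect (@sedge G) x y.

Section Complement.
Variable G : sgraph.

Definition compl_edge : rel G := fun x y => (x != y) && ~~ sedge x y.

Lemma compl_edge_sym : symmetric compl_edge.
Proof. by move=> x y; rewrite /compl_edge eq_sym sedge_sym. Qed.

Lemma compl_edge_irrefl : irreflexive compl_edge.
Proof. by move=> x; rewrite /compl_edge eqxx. Qed.

Definition sg_compl : sgraph :=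
  SGraph compl_edge_sym compl_edge_irrefl (sgraph_nonempty G).
End Complement.

Section PowerDomination.
Variable G : sgraph.
Implicit Types (v : G) (S A : {set G}).

Definition nbhd v : {set G} := [set u | sedge v u].
Definition cnbhd v : {set G} := v |: nbhd v.
Definition cnbhds S : {set G} := \bigcup_(v in S) cnbhd v.

(* One round of the while loop; the final set does not depend on which
   eligible vertex is picked (see [PD_least]). *)
Definition pd_step A : {set G} :=
  if [pick v in A | #|nbhd v :\: A| == 1] is Some v then A :|: nbhd v else A.

(* Each effective round adds a vertex, so #|G| rounds exhaust the loop
   (see [PD_terminal]). *)
Definition PD S : {set G} := iter #|G| pd_step (cnbhds S).

Definition power_dominating S : bool := PD S == [set: G].

(* The argument [set: G] only witnesses that power dominating sets exist
   (see [power_dominatingT]). *)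
Definition gammaP : nat :=
  #|[arg min_(S < [set: G] | power_dominating S) #|S|]|.

Lemma pd_step_sub A : A \subset pd_step A.
Proof. by rewrite /pd_step; case: pickP => // v _; apply: subsetUl. Qed.

Lemma pd_step_grow A :
  (exists2 v, v \in A & #|nbhd v :\: A| == 1) -> #|A| < #|pd_step A|.
Proof.
case=> v vA v1; rewrite /pd_step; case: pickP => [w /andP[_ w1]|/(_ v)].
  apply: proper_card; rewrite properE subsetUl subUset subxx /=.
  by rewrite -setD_eq0; apply/negP => /eqP w0; rewrite w0 cards0 in w1.
by rewrite vA v1.
Qed.

Lemma PD_sub S : cnbhds S \subset PD S.
Proof.
rewrite /PD; elim: #|G| => //= n IH.
exact: subset_trans IH (pd_step_sub _).
Qed.

Lemma PD_terminal S v : v \in PD S -> #|nbhd v :\: PD S| != 1.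
Proof.
move=> vP; apply/negP => v1.
have stop A : (forall w, w \in A -> #|nbhd w :\: A| != 1) -> pd_step A = A.
  by move=> h; rewrite /pd_step; case: pickP => // w /andP[/h/negbTE->].
have big k : k <= #|G| -> k <= #|iter k pd_step (cnbhds S)|.
  elim: k => //= k IH kG.
  set A := iter k _ _ in IH *.
  case: (altP (@existsP _ (fun w => (w \in A) && (#|nbhd w :\: A| == 1)))).
    case=> w /andP[wA w1]; apply: leq_ltn_trans (IH (ltnW kG)) _.
    by apply: pd_step_grow; exists w.
  move=> /existsPn nA.
  have sA : pd_step A = A.
    by apply: stop => w wA; have := nA w; rewrite wA.
  suff eqA : PD S = A.
    by have := nA v; rewrite -eqA vP v1.
  rewrite /PD -(subnK (ltnW kG)) iterD -/A.
  by elim: (#|G| - k) => //= m ->.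
have := big _ (leqnn _); rewrite -/(PD S) => PG.
have PT : PD S = setT by apply/eqP; rewrite eqEcard subsetT cardsT.
by move: v1; rewrite PT setDT cards0.
Qed.

Lemma PD_least S A : cnbhds S \subset A ->
  (forall v, v \in A -> #|nbhd v :\: A| != 1) -> PD S \subset A.
Proof.
move=> SA clA; rewrite /PD; elim: #|G| => //= n.
set B := iter n _ _ => BA; rewrite /pd_step; case: pickP => // v /andP[vB vB1].
rewrite subUset BA -setD_eq0 -cards_eq0 /=.
have := clA _ (subsetP BA _ vB).
have : #|nbhd v :\: A| <= 1 by rewrite -(eqP vB1) subset_leq_card ?setDS.
by case: #|_| => [|[]].
Qed.

Lemma power_dominatingT : power_dominating [set: G].
Proof.
rewrite /power_dominating -subTset; apply: subset_trans (PD_sub _).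
apply/subsetP => v _; apply/bigcupP; exists v => //.
by rewrite /cnbhd setU11.
Qed.
End PowerDomination.

Definition sg_iso (G K : sgraph) : Prop :=
  exists f : G -> K,
    bijective f /\ (forall x y, sedge (f x) (f y) = sedge x y).

Section Pendants.
Variables (H : sgraph) (p : pred H).

(* [inl v] is the vertex v of H; [inr (v, true)] and [inr (v, false)] are the
   new vertices v' and v'', which are adjacent to each other iff [p v]. *)
Definition pendant_edge : rel (H + H * bool) := fun a b =>
  match a, b with
  | inl u, inl v => sedge u v
  | inl u, inr (v, _) => u == v
  | inr (u, _), inl v => u == v
  | inr (u, i), inr (v, j) => [&& u == v, i != j & p u]
  end.

Lemma pendant_edge_sym : symmetric pendant_edge.
Proof.
move=> [u|[u i]] [v|[v j]] //=; first exact: sedge_sym.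
by rewrite [u == v]eq_sym [i == j]eq_sym; case: eqP => [->|].
Qed.

Lemma pendant_edge_irrefl : irreflexive pendant_edge.
Proof. by case=> [u|[u i]] /=; rewrite ?sedge_irrefl ?eqxx. Qed.

Lemma pendant_nonempty : 0 < #|{: H + H * bool}|.
Proof. by rewrite card_sum addn_gt0 sgraph_nonempty. Qed.

Definition pendant_graph : sgraph :=
  SGraph pendant_edge_sym pendant_edge_irrefl pendant_nonempty.
End Pendants.

Definition family_T (G : sgraph) : Prop :=
  exists (H : sgraph) (p : pred H),
    sg_connected H /\ sg_iso G (pendant_graph p).

(* Main.v *)
(* Write a and b for the power domination numbers of G and its complement, with
   b <= a. In a minimum power dominating set whose vertices have degree at least
   3 and which induces as few isolated vertices as possible, every vertex has two
   external private neighbours; so 3 a <= n when a > 1, which settles b = 1. If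
   3 a = n, the vertex set splits into triples (v and its two private
   neighbours), no edges join the private neighbours of different triples, and
   then b = 1; so 3 a < n when b = 2.

   If b >= 3, then any b - 1 vertices have a common neighbour in G, so any set of
   (b - 1) m vertices is dominated by m vertices. Starting from a single vertex,
   this gives a lower bound on its number of non-neighbours, and, exchanging G and
   its complement, n >= 2ab - 3(a + b) + 9. Only b = 3 is left, where a second
   greedily chosen vertex suffices except when a = b = 3. *)
Require Import Defs.
From mathcomp Require Import all_boot all_order all_algebra.
From mathcomp Require Import zify.
Set Implicit Arguments.
Unset Strict Implicit.
Unset Printing Implicit Defensive.

(** * Power dominating sets *)

Section General.
Variable G : sgraph.
Implicit Types (v w x y : G) (S T A : {set G}).

(** The sets to which the propagation rule adds nothing. *)
Definition stalled A : Prop :=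
  forall v, v \in A -> #|nbhd v :\: A| != 1.

Lemma nbhdC v w : (w \in nbhd v) = (v \in nbhd w).
Proof. by rewrite !inE sedge_sym. Qed.

Lemma nbhd_neq v w : w \in nbhd v -> w != v.
Proof. by apply: contraTneq => ->; rewrite inE sedge_irrefl. Qed.

Lemma cnbhdE v w : (w \in cnbhd v) = (w == v) || (w \in nbhd v).
Proof. by rewrite !inE. Qed.

Lemma cnbhdsP S x :
  reflect (exists2 v, v \in S & x \in cnbhd v) (x \in cnbhds S).
Proof. exact: bigcupP. Qed.

Lemma sub_cnbhds S : S \subset cnbhds S.
Proof. by apply/subsetP => v vS; apply/cnbhdsP; exists v; rewrite ?cnbhdE ?eqxx. Qed.

Lemma nbhd_sub_cnbhds S v : v \in S -> nbhd v \subset cnbhds S.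
Proof.
by move=> vS; apply/subsetP => x xv; apply/cnbhdsP; exists v; rewrite ?cnbhdE ?xv ?orbT.
Qed.

Lemma cnbhdsS S T : S \subset T -> cnbhds S \subset cnbhds T.
Proof.
move=> /subsetP sST; apply/subsetP => x /cnbhdsP[v /sST vT xv].
by apply/cnbhdsP; exists v.
Qed.

(** [PD S] is the least stalled set containing [cnbhds S]. This form frees later arguments from the
    iteration and from the order of forcing. *)
Lemma power_dominatingP S :
  power_dominating S <->
  (forall A, cnbhds S \subset A -> stalled A -> A = setT).
Proof.
split=> [/eqP PT A SA stA | h].
  by apply/eqP; rewrite -subTset -PT; apply: PD_least.
apply/eqP/h; first exact: PD_sub.
exact: PD_terminal.
Qed.

Lemma stalled_sub A v x :
  stalled A -> v \in A -> nbhd v :\ x \subset A -> nbhd v \subset A.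
Proof.
move=> stA vA sub; have := stA v vA.
have : nbhd v :\: A \subset [set x].
  apply/subsetP => y; rewrite in_setD => /andP[yA yv]; rewrite inE.
  by apply: contraR yA => yx; apply: (subsetP sub); rewrite in_setD1 yx.
by rewrite subset1 => /orP[/eqP->|]; rewrite ?cards1 // setD_eq0.
Qed.

Lemma stalled_le1 A v :
  stalled A -> v \in A -> #|nbhd v :\: A| <= 1 -> nbhd v \subset A.
Proof.
move=> stA vA; rewrite leq_eqVlt (negbTE (stA v vA)) /=.
by rewrite ltnS leqn0 cards_eq0 setD_eq0.
Qed.

Lemma power_dominating_sub S T :
  (forall A, cnbhds T \subset A -> stalled A -> cnbhds S \subset A) ->
  power_dominating S -> power_dominating T.
Proof.
move=> h /power_dominatingP pS; apply/power_dominatingP => A TA stA.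
by apply: pS => //; apply: h.
Qed.

Lemma power_dominatingS S T :
  S \subset T -> power_dominating S -> power_dominating T.
Proof.
move=> sST; apply: power_dominating_sub => A TA _.
exact: subset_trans (cnbhdsS sST) TA.
Qed.

Lemma gammaP_le S : power_dominating S -> gammaP G <= #|S|.
Proof.
rewrite /gammaP; case: arg_minnP; first exact: power_dominatingT.
by move=> i _ h /h.
Qed.

Lemma gammaP_witness : exists2 S : {set G}, power_dominating S & #|S| = gammaP G.
Proof.
rewrite /gammaP; case: arg_minnP; first exact: power_dominatingT.
by move=> i pi _; exists i.
Qed.

Lemma power_dominating_neq0 S : power_dominating S -> S != set0.
Proof.
move=> /power_dominatingP pS; apply/eqP => S0.
have e : set0 = [set: G].
  by apply: pS => [|v]; rewrite ?S0 /cnbhds ?big_set0 // inE.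
have /card_gt0P [x _] := sgraph_nonempty G.
by have := in_setT x; rewrite -e inE.
Qed.

Lemma gammaP_gt0 : 0 < gammaP G.
Proof.
by have [S pS <-] := gammaP_witness; rewrite card_gt0 power_dominating_neq0.
Qed.

Lemma connected_closed A :
  sg_connected G -> A != set0 -> (forall v, v \in A -> nbhd v \subset A) ->
  A = setT.
Proof.
move=> cG /set0Pn [x xA] h; apply/setP => y; rewrite inE.
have /connectP [p + ->] := cG x y.
elim: p x xA => //= z p IH x xA /andP[xz pz].
by apply: (IH z) => //; apply: (subsetP (h x xA)); rewrite inE.
Qed.

(** Only [x] can be missing, so a stalled [A] contains all neighbours of its vertices and
    connectedness applies. Hence a set that leaves one vertex undominated is still power
    dominating. *)
Lemma stalled_all_but_one A x :
  sg_connected G -> A != set0 -> stalled A -> ~: A \subset [set x] -> A = setT.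
Proof.
move=> cG A0 stA sub; apply: connected_closed => // v vA.
apply: (@stalled_sub _ _ x) => //; apply/subsetP => y /setD1P [yx _].
by apply: contraR yx => yA; have := subsetP sub y; rewrite !inE => ->.
Qed.

Lemma almost_dominating S x :
  sg_connected G -> S != set0 -> ~: cnbhds S \subset [set x] ->
  power_dominating S.
Proof.
move=> cG /set0Pn [v vS] sub; apply/power_dominatingP => A SA stA.
apply: (@stalled_all_but_one _ x) => //.
  apply/set0Pn; exists v; apply: (subsetP SA); exact: (subsetP (sub_cnbhds S)).
by apply: subset_trans sub; rewrite setCS.
Qed.

Lemma almost_dominating_card S :
  sg_connected G -> S != set0 -> #|~: cnbhds S| <= 1 -> power_dominating S.
Proof.
move=> cG S0 le1; case: (set_0Vmem (~: cnbhds S)) => [e|[x xS]].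
  have /set0Pn [x _] := S0.
  by apply: (@almost_dominating _ x); rewrite ?e ?sub0set.
apply: (@almost_dominating _ x) => //; apply/subsetP => y yS.
by rewrite inE (card_le1_eqP le1 _ _ yS xS).
Qed.

End General.

(** * Private neighbours *)

Section ZKC.
Variable G : sgraph.
Implicit Types (u v w x y : G) (S T A : {set G}).

Lemma card_replace S v w : v \in S -> #|w |: S :\ v| <= #|S|.
Proof. by move=> vS; rewrite cardsU1 (cardsD1 v S) vS leq_add2r; case: (_ \notin _). Qed.

(** [w] observes [v]; at most one other neighbour of [v] remains, and [v] forces it. So all that [v]
    dominated is observed. *)
Lemma power_dominating_slide S v w :
  v \in S -> #|nbhd v| <= 2 -> w \in nbhd v -> power_dominating S ->
  power_dominating (w |: S :\ v).
Proof.
move=> vS dv wv; apply: power_dominating_sub => A TA stA.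
have wA : cnbhd w \subset A.
  by apply: subset_trans TA; apply/subsetP => x xw; apply/cnbhdsP; exists w; rewrite ?setU11.
have vA : v \in A by apply: (subsetP wA); rewrite cnbhdE -nbhdC wv orbT.
have nA : nbhd v \subset A.
  apply: stalled_le1 => //; have := cardsD1 w (nbhd v); rewrite wv => e.
  apply: (@leq_trans #|nbhd v :\ w|); last by lia.
  by apply/subset_leq_card/setDS; rewrite sub1set (subsetP wA) // cnbhdE eqxx.
apply/subsetP => x /cnbhdsP [u uS xu]; have [uv|uv] := eqVneq u v.
  by move: xu; rewrite uv cnbhdE => /orP[/eqP->//|]; apply/subsetP.
by apply: (subsetP TA); apply/cnbhdsP; exists u => //; rewrite !inE uv uS orbT.
Qed.

(** Slides are repeated along a path to [z], until a vertex of degree at least 3 is met or the path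
    ends. *)
Lemma power_dominating_slide_connect S v z :
  power_dominating S -> v \in S -> connect (@sedge G) v z ->
  exists u, (3 <= #|nbhd u| \/ u = z) /\ power_dominating (u |: S :\ v).
Proof.
move=> pS vS /connectP [p]; elim: p v S pS vS => [|w p IH] v S pS vS /=.
  by move=> _ ->; exists v; split; [right | rewrite setD1K].
move=> /andP[vw pw] ez; have [d3|d2] := leqP 3 #|nbhd v|.
  by exists v; split; [left | rewrite setD1K].
have pS1 : power_dominating (w |: S :\ v).
  by apply: power_dominating_slide => //; rewrite inE.
have [|u [hu pu]] := IH w _ pS1 _ pw ez; first by rewrite setU11.
exists u; split => //; apply: power_dominatingS pu; apply: setUS.
by apply/subsetP => x; rewrite !inE; case: eqP.
Qed.

(** With degrees at most 2, a vertex of a minimum set could slide all the way onto another one,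
    which saves a vertex. *)
Lemma gammaP_le1 : sg_connected G -> (forall v, #|nbhd v| <= 2) -> gammaP G <= 1.
Proof.
move=> cG d2; have [S pS cS] := gammaP_witness G.
rewrite leqNgt -cS; apply/negP => /card_gt1P [v [z [vS zS vz]]].
have [u [hu pu]] := power_dominating_slide_connect pS vS (cG v z).
have uz : u = z by case: hu => //; have := d2 u; lia.
have := gammaP_le pu; rewrite uz (setUidPr _) ?sub1set ?inE 1?eq_sym ?vz //.
by rewrite -cS (cardsD1 v S) vS; lia.
Qed.

(** Induction on the number of chosen vertices of degree below 3: such a vertex slides towards [z]
    and stops at a vertex of degree at least 3. *)
Lemma gammaP_degree3 : sg_connected G -> (exists v, 3 <= #|nbhd v|) ->
  exists2 S : {set G}, power_dominating S /\ #|S| = gammaP G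
                     & forall v, v \in S -> 3 <= #|nbhd v|.
Proof.
move=> cG [z dz]; have [S0 pS0 cS0] := gammaP_witness G.
pose low S := [set v in S | #|nbhd v| < 3].
have [k] := ubnP #|low S0|; elim: k S0 pS0 cS0 => // k IH S pS cS lk.
have [l0|[v]] := set_0Vmem (low S).
  exists S => // v vS; rewrite leqNgt; apply/negP => dv.
  by have := in_set0 v; rewrite -l0 inE vS dv.
rewrite inE => /andP[vS dv].
have [u [hu pu]] := power_dominating_slide_connect pS vS (cG v z).
have du : 3 <= #|nbhd u| by case: hu => [|->].
apply: (IH _ pu).
  by apply/eqP; rewrite eqn_leq gammaP_le // -cS card_replace.
rewrite -ltnS; apply: leq_trans lk; rewrite ltnS; apply: proper_card.
apply/properP; split.
  apply/subsetP => x; rewrite !inE => /andP[/orP[/eqP->|/andP[_ ->//]]].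
  by lia.
exists v; rewrite inE ?vS ?dv // !inE eqxx /= orbF.
by apply/negP => /andP[/eqP e _]; move: dv; rewrite e; lia.
Qed.

(* External private neighbors of [v] with respect to [S], for [v \in S]. *)
Definition epn S v : {set G} := nbhd v :\: cnbhds (S :\ v).

(** Once [v] is observed thanks to [T], it forces its private neighbour, if there is one; its other
    neighbours are dominated by [S :\ v]. *)
Lemma power_dominating_drop S T v :
  power_dominating S -> S :\ v \subset T ->
  (forall A, cnbhds T \subset A -> stalled A -> v \in A) ->
  #|epn S v| <= 1 -> power_dominating T.
Proof.
move=> pS sT hv e1; apply: (power_dominating_sub _ pS) => A TA stA.
have SA := subset_trans (cnbhdsS sT) TA.
have vA := hv A TA stA.
have nA : nbhd v \subset A.
  apply: stalled_le1 => //; apply: leq_trans e1.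
  exact/subset_leq_card/setDS.
apply/subsetP => x /cnbhdsP [u uS xu]; have [uv|uv] := eqVneq u v.
  by move: xu; rewrite uv cnbhdE => /orP[/eqP->//|]; apply/subsetP.
by apply: (subsetP SA); apply/cnbhdsP; exists u => //; rewrite !inE uv uS.
Qed.

Lemma gammaP_private : sg_connected G -> (exists v, 3 <= #|nbhd v|) ->
  exists S : {set G},
    [/\ power_dominating S, #|S| = gammaP G,
        forall v, v \in S -> 3 <= #|nbhd v|
      & forall v, v \in S -> 2 <= #|epn S v|].
Proof.
move=> cG ez; have [S0 [pS0 cS0] dS0] := gammaP_degree3 cG ez.
pose good S := [&& power_dominating S, #|S| == gammaP G
                 & [forall v in S, 3 <= #|nbhd v|]].
pose iso S := [set v in S | [disjoint nbhd v & S]].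
have gS0 : good S0.
  by rewrite /good pS0 cS0 eqxx; apply/forallP => v; apply/implyP => /dS0.
case: (arg_minnP (fun S => #|iso S|) gS0) => S /and3P[pS /eqP cS /forallP dS] mS.
have {}dS v : v \in S -> 3 <= #|nbhd v| by move=> vS; apply: implyP (dS v) vS.
exists S; split => // v vS; rewrite leqNgt ltnS; apply/negP => e1.
have noD : ~ power_dominating (S :\ v).
  by move=> /gammaP_le; rewrite -cS (cardsD1 v S) vS; lia.
have [vN|vN] := boolP (v \in cnbhds (S :\ v)).
  by apply/noD/(power_dominating_drop (v := v) pS) => // A /subsetP /(_ v vN).
have isov x : x \in S -> x \notin nbhd v.
  move=> xS; apply: contra vN => xv; apply/cnbhdsP; exists x.
    by rewrite !inE xS (nbhd_neq xv).
  by rewrite cnbhdE -nbhdC xv orbT.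
(* Of the at least three neighbours of [v], at most one is private. *)
have [w wv wN] : exists2 w, w \in nbhd v & w \in cnbhds (S :\ v).
  apply/exists_inP; apply: contraT; rewrite negb_exists_in => /forall_inP h.
  have : nbhd v \subset epn S v.
    by apply/subsetP => x xv; rewrite inE xv h.
  by move=> /subset_leq_card; have := dS v vS; lia.
have wS : w \notin S by apply: contraL wv => /isov.
have [u uS uw] : exists2 u, u \in S :\ v & w \in nbhd u.
  have /cnbhdsP [u uS] := wN; rewrite cnbhdE => /orP[/eqP wu|]; last by exists u.
  by case/setD1P: uS => _ uS; rewrite wu uS in wS.
have /setD1P [uv uS'] := uS.
have pS' : power_dominating (w |: S :\ v).
  apply: (power_dominating_drop (v := v) pS) => //; first exact: subsetUr.
  move=> A /subsetP TA _; apply: TA; apply/cnbhdsP; exists w; rewrite ?setU11 //.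
  by rewrite cnbhdE -nbhdC wv orbT.
have [dw|dw] := leqP 3 #|nbhd w|.
  have : good (w |: S :\ v).
    rewrite /good pS' eqn_leq gammaP_le // -cS card_replace //=.
    apply/forall_inP => x; rewrite !inE => /orP[/eqP->//|/andP[_]].
    exact: dS.
  (* Exchanging [v] for [w] removes the isolated vertex [v] and creates none, as [w] is adjacent to
     [u]. *)
  move=> /mS; apply/negP; rewrite -ltnNge; apply: proper_card.
  apply/properP; split; last first.
    exists v; rewrite inE ?vS /=.
      rewrite disjoint_sym disjoint_subset; apply/subsetP => x xS.
      by rewrite inE isov.
    rewrite !inE eqxx /= orbF; apply/negP => /andP[/eqP e].
    by rewrite -e vS in wS.
  apply/subsetP => x; rewrite !inE => /andP[/orP[/eqP->|/andP[xv xS]]] dx.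
    have := disjointFr dx (x := u); rewrite -nbhdC uw !inE uv uS' orbT.
    by move=> /(_ isT).
  rewrite xS disjoint_subset; apply/subsetP => y yx; apply/negP => /= yS.
  have [yv|yv] := eqVneq y v.
    by have := isov x xS; rewrite nbhdC -yv yx.
  by have := disjointFr dx yx; rewrite !inE yv yS orbT.
(* Now [w] has only the neighbours [u] and [v]; both [u] and [w] are observed without [v], so [w]
   forces [v]. *)
apply: noD; apply: (power_dominating_drop (v := v) pS) => // A /subsetP TA stA.
have wA : w \in A by apply: TA.
have uA : u \in A by apply/TA/(subsetP (sub_cnbhds _)).
have : nbhd w \subset A.
  apply: stalled_le1 => //; have := cardsD1 u (nbhd w); rewrite -nbhdC uw => e.
  apply: (@leq_trans #|nbhd w :\ u|); last by move: dw; rewrite e.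
  by apply/subset_leq_card/setDS; rewrite sub1set.
by move=> /subsetP; apply; rewrite -nbhdC.
Qed.

End ZKC.

(** * The bound by a third of the order *)

Section Third.
Variable G : sgraph.
Implicit Types (u v w x y : G) (S T A : {set G}).

Lemma epn_notin S v x : v \in S -> x \in epn S v -> x \notin S.
Proof.
move=> vS; rewrite inE => /andP[xN /nbhd_neq xv]; apply: contra xN => xS.
by apply: (subsetP (sub_cnbhds _)); rewrite !inE xv.
Qed.

Lemma epn_private S u v x :
  v \in S -> x \in epn S v -> u \in S -> x \in nbhd u -> u = v.
Proof.
move=> vS; rewrite inE => /andP[xN _] uS xu; apply: contraNeq xN => uv.
by apply: (subsetP (nbhd_sub_cnbhds (v := u) _)) => //; rewrite !inE uv.
Qed.

Lemma epn_nbhd S v x : x \in epn S v -> x \in nbhd v.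
Proof. by rewrite inE => /andP[]. Qed.

(** The blocks formed by each [v] in [S] and its private neighbours are disjoint and have at least 3
    elements. Equality makes every block a triple and the blocks a partition; [leqif] tracks
    this. *)
Lemma gammaP_third : sg_connected G -> 1 < gammaP G ->
  3 * gammaP G <= #|G| /\
  (3 * gammaP G = #|G| ->
   exists S : {set G},
    [/\ #|S| = gammaP G, power_dominating S,
        forall v, v \in S -> 3 <= #|nbhd v|,
        forall v, v \in S -> #|epn S v| = 2
      & forall x, x \in S \/ exists2 v, v \in S & x \in epn S v]).
Proof.
move=> cG g1.
have ez : exists v, 3 <= #|nbhd v|.
  apply/existsP; apply: contraLR g1 => /existsPn h; rewrite -leqNgt.
  by apply: gammaP_le1 => // v; have := h v; rewrite -ltnNge.
have [S [pS cS dS eS]] := gammaP_private cG ez.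
pose own x := [set v in S | (x == v) || (x \in epn S v)].
have own1 x : #|own x| <= 1.
  apply/card_le1_eqP => u v.
  have pr w : w \in S -> x \in epn S w -> x \notin S by apply: epn_notin.
  rewrite in_set => /andP[uS ux]; rewrite in_set => /andP[vS vx].
  have [xS|xS] := boolP (x \in S).
    case/orP: ux => [/eqP<-|/(pr _ uS)]; last by rewrite xS.
    by case/orP: vx => [/eqP<-|/(pr _ vS)]; last by rewrite xS.
  case/orP: ux => [/eqP xu|xu]; first by rewrite xu uS in xS.
  case/orP: vx => [/eqP xv|xv]; first by rewrite xv vS in xS.
  exact: epn_private uS xu vS (epn_nbhd xv).
have sum_own : \sum_x #|own x| = \sum_(v in S) #|epn S v|.+1.
  transitivity (\sum_x \sum_(v in S) ((x == v) || (x \in epn S v))).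
    apply: eq_bigr => x _; rewrite -sum1_card [RHS]big_mkcond [LHS]big_mkcond.
    by apply: eq_bigr => v _; rewrite in_set; case: (v \in S) => //=; case: (_ || _).
  rewrite exchange_big; apply: eq_bigr => v vS.
  have vN : v \notin epn S v by apply/negP => /(epn_notin vS); rewrite vS.
  have := cardsU1 v (epn S v); rewrite vN add1n => <-.
  rewrite -sum1_card [RHS]big_mkcond /=.
  by apply: eq_bigr => x _; rewrite in_setU1; case: (_ || _).
have le_own : \sum_x #|own x| <= \sum_(x : G) 1 ?= iff [forall x, #|own x| == 1].
  by apply: leqif_sum => x _; apply/leqif_eq.
have le_epn : \sum_(v in S) 3 <= \sum_(v in S) #|epn S v|.+1
     ?= iff [forall (v | v \in S), 3 == #|epn S v|.+1].
  by apply: leqif_sum => v vS; apply/leqif_eq/eS.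
move: le_own le_epn; rewrite sum1_card sum_own sum_nat_const cS mulnC.
move=> [le1 eq1] [le2 eq2]; split; first exact: leq_trans le2 le1.
move=> e; exists S.
have e1 : \sum_(v in S) #|epn S v|.+1 = #|G| by apply/eqP; rewrite eqn_leq le1 -{1}e.
move: eq1 eq2; rewrite e1 e !eqxx => /esym/forallP o1 /esym/forall_inP o2.
split=> // [v vS|x]; first by have /eqP[] := o2 v vS.
have /card_gt0P [v] : 0 < #|own x| by rewrite (eqP (o1 x)).
by rewrite inE => /andP[vS /orP[/eqP->|xv]]; [left | right; exists v].
Qed.

End Third.

(** * Equality in the bound by a third of the order *)

Section ThirdEquality.
Variable G : sgraph.
Implicit Types (u v w x y : G) (S T A : {set G}).

Lemma in_nbhd_compl (x y : sg_compl G) :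
  (y \in nbhd x) = (x != y) && (y \notin @nbhd G x).
Proof. by rewrite !inE. Qed.

Hypothesis cG : sg_connected G.
Hypothesis cGc : sg_connected (sg_compl G).

Variable S : {set G}.
Hypothesis minS : #|S| = gammaP G.
Hypothesis pS : power_dominating S.
Hypothesis degS : forall v, v \in S -> 3 <= #|nbhd v|.
Hypothesis epn2 : forall v, v \in S -> #|epn S v| = 2.
Hypothesis tripleS : forall x, x \in S \/ exists2 v, v \in S & x \in epn S v.

Let smaller T : #|T| < #|S| -> ~ power_dominating T.
Proof. by move=> lt /gammaP_le; rewrite -minS; lia. Qed.

Let dropS v : v \in S -> ~ power_dominating (S :\ v).
Proof. by move=> vS; apply: smaller; rewrite (cardsD1 v S) vS; lia. Qed.

Lemma nbhd_triple v w :
  v \in S -> w \in nbhd v -> w \notin S -> w \in epn S v.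
Proof.
move=> vS wv; have [->//|[u uS wu _]] := tripleS w.
by rewrite (epn_private uS wu vS wv).
Qed.

(** Only two of the at least three neighbours of [v] are private, and any further one lies in
    [S]. *)
Lemma triple_nbr v : v \in S -> exists2 u, u \in S & v \in nbhd u.
Proof.
move=> vS; have [w] : exists w, w \in nbhd v :\: epn S v.
  apply/set0Pn; rewrite setD_eq0; apply/negP => /subset_leq_card.
  by rewrite epn2 //; have := degS vS; lia.
rewrite inE => /andP[wN wv]; exists w; last by rewrite -nbhdC.
by apply: contraR wN; apply: nbhd_triple.
Qed.

Lemma triple_cnbhds v x : v \in S -> x \notin epn S v -> x \in cnbhds (S :\ v).
Proof.
move=> vS xN; have [u uS vu] := triple_nbr vS.
have [xS|[w wS xw]] := tripleS x.
  have [->|xv] := eqVneq x v.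
    apply: (subsetP (nbhd_sub_cnbhds (v := u) _)) => //.
    by rewrite !inE uS andbT; apply: contraTneq vu => ->; rewrite inE sedge_irrefl.
  by apply: (subsetP (sub_cnbhds _)); rewrite !inE xv.
apply: (subsetP (nbhd_sub_cnbhds (v := w) _)); last exact: epn_nbhd xw.
by rewrite !inE wS andbT; apply: contraNneq xN => <-.
Qed.

(* Otherwise [x] would force one of [p], [q], then [v] the other, and
   [S :\ v] would be power dominating. *)
Lemma triple_twin v x p q : v \in S -> x \notin epn S v ->
  p \in epn S v -> q \in epn S v -> x \in nbhd p -> x \in nbhd q.
Proof.
move=> vS xN pv qv xp; have [<-//|pq] := eqVneq p q.
have epnE : epn S v = [set p; q].
  apply/esym/eqP; rewrite eqEcard subUset !sub1set pv qv epn2 //.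
  by rewrite cards2 pq.
apply: contraT => xq; case: (dropS vS); apply/power_dominatingP => A TA stA.
have outA y : y \notin A -> y = p \/ y = q.
  move=> yA; have : y \in epn S v.
    by apply: contraR yA => yN; apply/(subsetP TA)/triple_cnbhds.
  by rewrite epnE !inE => /orP[/eqP|/eqP]; auto.
have xA : x \in A by apply/(subsetP TA)/triple_cnbhds.
have vA : v \in A.
  apply/(subsetP TA)/triple_cnbhds => //.
  by apply/negP => /(epn_notin vS); rewrite vS.
have pA : p \in A.
  apply: (subsetP (stalled_sub (x := p) stA xA _)); last by rewrite nbhdC.
  apply/subsetP => y /setD1P[yp yx].
  apply: contraT => /outA [/eqP|yq]; first by rewrite (negbTE yp).
  by rewrite nbhdC -yq yx in xq.
have qA : q \in A.
  apply: (subsetP (stalled_sub (x := q) stA vA _)); last exact: epn_nbhd qv.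
  apply/subsetP => y /setD1P[yq _]; apply: contraT => yA.
  by case: (outA y yA) => [yp|/eqP]; [rewrite -yp (negbTE yA) in pA | rewrite (negbTE yq)].
apply/setP => y; rewrite [RHS]inE; apply: contraT => yA.
by case: (outA y yA) => e; move: yA; rewrite e ?pA ?qA.
Qed.

(** Otherwise [v] and [u] could be traded for [p] alone: [p] dominates [v] and, by [triple_twin],
    both private neighbours of [u], while [w] dominates [u]. Only the other private neighbour [q] of
    [v] is left. *)
Lemma linked_triples_nbr v u p r w :
  v \in S -> u \in S -> u != v -> p \in epn S v -> r \in epn S u ->
  r \in nbhd p -> w \in S -> u \in nbhd w -> w = v.
Proof.
move=> vS uS uv pv ru rp wS uw; apply/eqP; apply: contraT => wv.
have wu : w != u by apply: contraTneq uw => ->; rewrite inE sedge_irrefl.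
have [q qE] : exists q, epn S v :\ p = [set q].
  by apply/cards1P; have := cardsD1 p (epn S v); rewrite pv epn2 // add1n => -[<-].
pose T := p |: S :\ v :\ u.
have NT z y : z \in T -> y \in nbhd z -> y \in cnbhds T.
  by move=> zT; apply/subsetP/nbhd_sub_cnbhds.
have pT : p \in T by rewrite !inE eqxx.
have ST z : z \in S -> z != v -> z != u -> z \in T by rewrite !inE => -> -> ->; rewrite orbT.
have pu : p \notin epn S u.
  by apply/negP => /(epn_private (u := v) uS) /(_ vS (epn_nbhd pv)) e; rewrite e eqxx in uv.
case: (@smaller T).
  apply: (@leq_ltn_trans #|S :\ v :\ u|.+1).
    by rewrite cardsU1 -add1n leq_add2r; case: (_ \notin _).
  by rewrite (cardsD1 v S) vS (cardsD1 u (S :\ v)) !inE uv uS.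
apply: (@almost_dominating _ _ q) => //.
  by apply/set0Pn; exists p.
apply/subsetP => y; rewrite -qE in_setC in_setD1; apply: contraR => yN.
have [yS|[z zS yz]] := tripleS y.
  have [->|yu] := eqVneq y u; first by apply: (NT w) => //; apply: ST.
  have [->|yv] := eqVneq y v; first by apply: (NT p) => //; rewrite -nbhdC; exact: epn_nbhd pv.
  by apply: (subsetP (sub_cnbhds _)); apply: ST.
have [zu|zu] := eqVneq z u.
  rewrite zu in yz; apply: (NT p) => //.
  by rewrite nbhdC; apply: (triple_twin uS pu ru yz); rewrite -nbhdC.
have [zv|zv] := eqVneq z v; last first.
  by apply: (NT z); [apply: ST | exact: epn_nbhd yz].
move: yN; rewrite zv in yz; rewrite yz andbT negbK => /eqP->.
exact: (subsetP (sub_cnbhds _)).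
Qed.

(* Two linked triples would form a copy of K_{3,3}, which is then all of [G]. *)
Lemma unlinked_triples v u p r :
  v \in S -> u \in S -> u != v -> p \in epn S v -> r \in epn S u ->
  r \notin nbhd p.
Proof.
move=> vS uS uv pv ru; apply/negP => rp.
have pr : p \in nbhd r by rewrite -nbhdC.
have vu : v != u by rewrite eq_sym.
have nu w : w \in S -> u \in nbhd w -> w = v.
  exact: (linked_triples_nbr vS uS uv pv ru rp).
have nv w : w \in S -> v \in nbhd w -> w = u.
  exact: (linked_triples_nbr uS vS vu ru pv pr).
have uNv : u \in nbhd v by have [w wS uw] := triple_nbr uS; rewrite -(nu w wS uw).
(* The two sides of the K_{3,3}. *)
pose B := v |: epn S u; pose C := u |: epn S v.
have notin z z' y : z \in S -> z' \in S -> z != z' -> y \in epn S z -> y \notin epn S z'.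
  move=> zS z'S zz' yz; apply/negP => yz'.
  by rewrite (epn_private z'S yz' zS (epn_nbhd yz)) eqxx in zz'.
have linked p' r' : p' \in epn S v -> r' \in epn S u -> r' \in nbhd p'.
  move=> p'v r'u.
  have pr' : p \in nbhd r' by apply: (triple_twin uS _ ru r'u pr); exact: notin pv.
  apply: (triple_twin vS _ pv p'v); first exact: notin r'u.
  by rewrite -nbhdC.
have BC b c : b \in B -> c \in C -> c \in nbhd b.
  rewrite !in_setU1 => /orP[/eqP->|bu] /orP[/eqP->|cv] //.
  - exact: epn_nbhd cv.
  - by rewrite -nbhdC; exact: epn_nbhd bu.
  - by rewrite -nbhdC; apply: linked.
have all : B :|: C = setT.
  apply: connected_closed => //; first by apply/set0Pn; exists v; rewrite !inE eqxx.
  have closed z z' s s' : z \in S -> z' \in S -> z != z' ->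
      s \in epn S z -> s' \in epn S z' -> s' \in nbhd s ->
      forall x y, x \in z |: epn S z -> y \in nbhd x ->
      y \in (z |: epn S z) :|: (z' |: epn S z').
    move=> zS z'S zz' sz s'z' ss' x y; rewrite !in_setU !in_set1.
    have nz w : w \in S -> z \in nbhd w -> w = z'.
      apply: (linked_triples_nbr z'S zS zz' s'z' sz); by rewrite -nbhdC.
    move=> /orP[/eqP->|xz] yx.
      have [yS|yS] := boolP (y \in S).
        by rewrite (nz y yS) ?eqxx ?orbT // -nbhdC.
      by rewrite nbhd_triple ?orbT.
    have [yS|[w wS yw]] := tripleS y.
      by rewrite (epn_private zS xz yS) ?eqxx // -nbhdC.
    have [wz|wz] := eqVneq w z; first by rewrite -wz yw orbT.
    have [w' w'S zw'] := triple_nbr zS.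
    have zw : z != w by rewrite eq_sym.
    have xy : x \in nbhd y by rewrite -nbhdC.
    (* A link to the triple of [w] makes [w] the only neighbour of [z] in [S], hence [w] is [z']. *)
    have e := linked_triples_nbr wS zS zw yw xz xy w'S zw'.
    by rewrite -(nz w' w'S zw') e yw !orbT.
  have eUU : B :|: C = (v |: epn S v) :|: (u |: epn S u).
    by rewrite /B /C setUACA [epn S u :|: _]setUC -setUACA.
  move=> x; rewrite eUU in_setU => /orP[] xz; apply/subsetP => y yx.
    exact: (closed v u p r vS uS vu pv ru rp x y xz yx).
  by rewrite setUC; exact: (closed u v r p uS vS uv ru pv pr x y xz yx).
(* The complement has no edge between [B] and [C], so it would be disconnected. *)
have Bfull : B = [set: sg_compl G].
  apply: (@connected_closed (sg_compl G)) => //; first by apply/set0Pn; exists v; rewrite !inE eqxx.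
  move=> b bB; apply/subsetP => c; rewrite in_nbhd_compl => /andP[_ cN].
  have : c \in B :|: C by rewrite all.
  by rewrite in_setU => /orP[//|/(BC b c bB)]; rewrite (negbTE cN).
have : u \in B by rewrite Bfull.
rewrite in_setU1 (negbTE uv) /= => /(epn_notin uS); by rewrite uS.
Qed.

(** In [G] a private neighbour [p] of [v] is adjacent at most to [v] and the other one, [q]. So in
    the complement [p] dominates all but [v] and [q]; a [G]-neighbour [u] of [v] in [S] sees [q]
    there but not [v], and forces [q]. *)
Lemma triples_compl_le1 : gammaP (sg_compl G) <= 1.
Proof.
have /set0Pn [v vS] := power_dominating_neq0 pS.
have [u uS vu] := triple_nbr vS.
have uv : u != v by apply: contraTneq vu => ->; rewrite inE sedge_irrefl.
have [p [q [pv qv pq]]] : exists p q, [/\ p \in epn S v, q \in epn S v & p != q].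
  by apply/card_gt1P; rewrite epn2.
have [r ru] : exists r, r \in epn S u by apply/card_gt0P; rewrite epn2.
have epnE y : y \in epn S v -> y = p \/ y = q.
  suff -> : epn S v = [set p; q] by rewrite !inE => /orP[] /eqP; auto.
  apply/esym/eqP; rewrite eqEcard subUset !sub1set pv qv epn2 //.
  by rewrite cards2 pq.
have nbhd_p y : y \in nbhd p -> y = v \/ y = q.
  move=> yp; have [yS|[w wS yw]] := tripleS y.
    by left; apply: (epn_private vS pv yS); rewrite -nbhdC.
  right; have [wv|wv] := eqVneq w v.
    rewrite wv in yw; case: (epnE y yw) => // yep.
    by move: yp; rewrite yep inE sedge_irrefl.
  by have := unlinked_triples vS wS wv pv yw; rewrite yp.
have nuq y : y \in epn S v -> y \notin nbhd u.
  move=> yv; apply/negP => yu; rewrite (epn_private vS yv uS yu) eqxx in uv; by [].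
have neqS x y : x \in S -> y \in epn S v -> x != y.
  by move=> xS /(epn_notin vS); apply: contraNneq => <-.
rewrite -(cards1 (p : sg_compl G)); apply: gammaP_le; apply/power_dominatingP.
move=> A /subsetP pA stA.
have inA y : y != v -> y != q -> y \in A.
  move=> yv yq; apply: pA; apply/cnbhdsP; exists p; first by rewrite inE.
  rewrite cnbhdE in_nbhd_compl eq_sym; case: eqVneq => //= py.
  by apply/negP => /nbhd_p [] /eqP; apply/negP.
have uA : u \in A by apply: inA => //; apply: neqS.
have qA : q \in A.
  suff /subsetP/(_ q) : @nbhd (sg_compl G) u \subset A.
    by apply; rewrite in_nbhd_compl nuq // neqS.
  apply: (@stalled_sub (sg_compl G) A u q stA uA); apply/subsetP => y.
  rewrite in_setD1 in_nbhd_compl => /and3P[yq _ yu].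
  by apply: inA => //; apply: contraNneq yu => ->.
apply: (@stalled_all_but_one (sg_compl G) A v) => //; first by apply/set0Pn; exists u.
apply/subsetP => y; rewrite !inE; apply: contraR => yv.
by have [->|] := eqVneq y q; last exact: inA.
Qed.

End ThirdEquality.

Lemma gammaP_third_lt (G : sgraph) :
  sg_connected G -> sg_connected (sg_compl G) ->
  1 < gammaP G -> 1 < gammaP (sg_compl G) -> 3 * gammaP G < #|G|.
Proof.
move=> cG cGc g1 g1'; have [le3 h] := gammaP_third cG g1.
rewrite ltn_neqAle le3 andbT; apply/eqP => /h [S [cS pS dS eS tS]].
by have := triples_compl_le1 cG cGc cS pS dS eS tS; rewrite leqNgt g1'.
Qed.

(** * Covering by common neighbourhoods *)

(** The double complement is not definitionally [G], so exchanging the two graphs needs explicit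
    transport. *)
Lemma nbhd_compl_compl (G : sgraph) (v : G) :
  @nbhd (sg_compl (sg_compl G)) v = nbhd v.
Proof.
apply/setP => w; rewrite in_nbhd_compl (@in_nbhd_compl G v w).
by case: eqVneq => [->|_]; rewrite ?negbK //= inE sedge_irrefl.
Qed.

Lemma gammaP_compl_compl (G : sgraph) :
  gammaP (sg_compl (sg_compl G)) = gammaP G.
Proof.
have pE (S : {set G}) :
    @power_dominating (sg_compl (sg_compl G)) S <-> @power_dominating G S.
  have cE : @cnbhds (sg_compl (sg_compl G)) S = @cnbhds G S.
    by apply: eq_bigr => v _; rewrite /cnbhd nbhd_compl_compl.
  split=> /power_dominatingP h; apply/power_dominatingP => A.
    by rewrite -cE => SA stA; apply: h => // v /stA; rewrite nbhd_compl_compl.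
  by rewrite cE => SA stA; apply: h => // v /stA; rewrite nbhd_compl_compl.
apply/eqP; rewrite eqn_leq; apply/andP; split.
  by have [S pS <-] := gammaP_witness G; apply/gammaP_le/pE.
by have [S pS <-] := gammaP_witness (sg_compl (sg_compl G)); apply/gammaP_le/pE.
Qed.

Lemma sg_connected_compl_compl (G : sgraph) :
  sg_connected G -> sg_connected (sg_compl (sg_compl G)).
Proof.
move=> cG x y; have := cG x y; congr is_true; apply: eq_connect => u v.
by rewrite /= /compl_edge /= /compl_edge; case: eqVneq => [->|_];
  rewrite ?sedge_irrefl //= negbK.
Qed.

Section Cover.
Variable G : sgraph.
Implicit Types (u v w x y : G) (S T A R C : {set G}).

Definition cnbr T : {set G} := [set x | [forall t in T, sedge t x]].

Lemma cnbrE T : cnbr T = ~: @cnbhds (sg_compl G) T.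
Proof.
apply/setP => x; rewrite !inE; apply/forall_inP/idP => [h|].
  apply/cnbhdsP => -[t tT]; rewrite cnbhdE in_nbhd_compl !inE.
  have tx := h t tT; rewrite tx andbF orbF => /eqP xt.
  by rewrite xt sedge_irrefl in tx.
move=> h t tT; apply: contraR h => tx; apply/cnbhdsP; exists t => //.
by rewrite cnbhdE in_nbhd_compl !inE tx andbT eq_sym; case: eqP.
Qed.

(** Common neighbours of [T] are the vertices that [T] leaves undominated in the complement; with at
    most one of them [T] would be power dominating there. *)
Lemma cnbr_gt1 T :
  sg_connected (sg_compl G) -> #|T| < gammaP (sg_compl G) -> T != set0 ->
  1 < #|cnbr T|.
Proof.
move=> cGc lt T0; rewrite ltnNge cnbrE; apply: contraL lt => le1.
rewrite -leqNgt; apply: gammaP_le.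
by apply: (@almost_dominating_card (sg_compl G)).
Qed.

(** [R] is split into [m] batches of at most [k] vertices, each having a common neighbour. *)
Lemma cover_nbhd k R m :
  sg_connected (sg_compl G) -> k < gammaP (sg_compl G) -> #|R| <= k * m ->
  exists2 C : {set G}, #|C| <= m & R \subset \bigcup_(c in C) nbhd c.
Proof.
move=> cGc kg; elim: m R => [|m IH] R Rm.
  exists set0; rewrite ?cards0 //; move: Rm.
  by rewrite muln0 leqn0 cards_eq0 => /eqP->; apply: sub0set.
have [T TR cT] : exists2 T : {set G}, T \subset R & #|T| = minn k #|R|.
  have [T /andP[]] : exists T : {set G}, (T \subset R) && (#|T| == minn k #|R|).
    have [s [us sR ss]] : exists s : seq G, [/\ uniq s, {subset s <= R} & size s = minn k #|R|].
      exists (take (minn k #|R|) (enum R)); split.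
      - exact/take_uniq/enum_uniq.
      - by move=> x /mem_take; rewrite mem_enum.
      - by rewrite size_takel // -cardE geq_minr.
    exists [set x in s]; rewrite cardsE (card_uniqP us) ss eqxx andbT.
    by apply/subsetP => x; rewrite inE => /sR.
  by move=> ? /eqP ?; exists T.
have [C Cm RC] : exists2 C : {set G}, #|C| <= m & R :\: T \subset \bigcup_(c in C) nbhd c.
  by apply: IH; rewrite mulnS in Rm; have := cardsID T R; rewrite (setIidPr TR) cT; lia.
have [T0|T0] := eqVneq T set0.
  by exists C; [lia | move: RC; rewrite T0 setD0].
have /card_gt0P [c] : 0 < #|cnbr T|.
  by apply/ltnW/cnbr_gt1 => //; lia.
rewrite inE => /forall_inP cT'.
exists (c |: C); first by rewrite cardsU1; case: (c \in C) => /=; lia.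
apply/subsetP => x xR; apply/bigcupP; have [xT|xT] := boolP (x \in T).
  by exists c; [rewrite setU11 | rewrite -nbhdC inE cT'].
have /bigcupP [d dC xd] : x \in \bigcup_(c in C) nbhd c.
  by apply: (subsetP RC); rewrite inE xT.
by exists d; rewrite ?in_setU1 ?dC ?orbT.
Qed.

(** With at most [k * m + 1] undominated vertices, one may be left out and the others covered by [m]
    neighbourhoods, giving a power dominating set of size at most [#|S| + m]. *)
Lemma gammaP_greedy k S m :
  sg_connected G -> sg_connected (sg_compl G) -> k < gammaP (sg_compl G) ->
  S != set0 -> #|S| + m < gammaP G -> k * m + 2 <= #|~: cnbhds S|.
Proof.
move=> cG cGc kg /set0Pn [s sS]; apply: contraLR; rewrite -leqNgt -ltnNge => small.
have [R [RS Rm R1]] : exists R : {set G},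
    [/\ R \subset ~: cnbhds S, #|R| <= k * m & #|~: cnbhds S :\: R| <= 1].
  have [e|[x xS]] := set_0Vmem (~: cnbhds S).
    by exists set0; rewrite sub0set e setD0 !cards0.
  exists (~: cnbhds S :\ x); split; first exact: subD1set.
    by have := cardsD1 x (~: cnbhds S); rewrite xS; lia.
  rewrite setDDr setDv set0U; apply: leq_trans (subset_leq_card (subsetIr _ _)) _.
  by rewrite cards1.
have [C Cm RC] := cover_nbhd cGc kg Rm.
apply: (@leq_trans #|S :|: C|); last by rewrite cardsU; lia.
apply/gammaP_le/almost_dominating_card => //; first by apply/set0Pn; exists s; rewrite inE sS.
apply: leq_trans R1; apply/subset_leq_card/subsetP => x; rewrite !in_setD !in_setC => xN.
apply/andP; split; apply: contra xN; last exact/subsetP/cnbhdsS/subsetUl.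
move=> /(subsetP RC) /bigcupP [c cC xc].
by apply: (subsetP (nbhd_sub_cnbhds _)) xc; rewrite inE cC orbT.
Qed.

Lemma cnbhds1 v : cnbhds [set v] = cnbhd v.
Proof. exact: big_set1. Qed.

Lemma card_cnbhd v : #|cnbhd v| = #|nbhd v|.+1.
Proof. by rewrite cardsU1 inE sedge_irrefl. Qed.

Lemma card_nbhd_compl v : #|nbhd v| + #|@nbhd (sg_compl G) v| = #|G|.-1.
Proof.
have -> : #|@nbhd (sg_compl G) v| = #|~: cnbhd v|.
  by apply: eq_card => x; rewrite (@in_nbhd_compl G v x) !inE negb_or eq_sym.
have := cardsC (cnbhd v); rewrite card_cnbhd; lia.
Qed.

Lemma codegree_ge v a b :
  sg_connected G -> sg_connected (sg_compl G) ->
  gammaP G = a -> gammaP (sg_compl G) = b -> 1 < a -> 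
  b.-1 * (a - 2) + 2 <= #|@nbhd (sg_compl G) v|.
Proof.
move=> cG cGc ea eb a1; have b0 := gammaP_gt0 (sg_compl G).
have v0 : [set v] != set0 by apply/set0Pn; exists v; rewrite inE.
have : b.-1 * (a - 2) + 2 <= #|~: cnbhd v|.
  rewrite -cnbhds1; apply: gammaP_greedy => //; first by lia.
  by rewrite cards1; lia.
have := cardsC (cnbhd v); rewrite card_cnbhd; have := card_nbhd_compl v.
by lia.
Qed.

End Cover.

(** * Codegrees and twins *)

(** Both sides count ordered pairs of distinct elements of [F i], summed over [i]. *)
Lemma sum_off_diagonal_pairs (T I : finType) (P : pred I) (F : I -> {set T}) :
  \sum_x \sum_(y | y != x) \sum_(i | P i) ((x \in F i) && (y \in F i)) =
  \sum_(i | P i) #|F i| * #|F i|.-1.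
Proof.
under eq_bigr do rewrite exchange_big.
rewrite exchange_big; apply: eq_bigr => i _.
rewrite -sum_nat_const [RHS]big_mkcond; apply: eq_bigr => x _ /=.
case: ifP => xF; last by rewrite big1.
rewrite (cardsD1 x (F i)) xF add1n /= -sum1_card big_mkcond [RHS]big_mkcond.
by apply: eq_bigr => y _; rewrite !inE; case: (y != x); case: (y \in F i).
Qed.

Section Codegree.
Variable G : sgraph.
Implicit Types (u v w x y p q : G) (S T A R C : {set G}).

Definition cdeg x y := #|nbhd x :&: nbhd y|.

Lemma cnbr2 x y : cnbr [set x; y] = nbhd x :&: nbhd y.
Proof.
apply/setP => z; rewrite !inE; apply/forall_inP/andP => [h|[xz yz] t].
  by rewrite !h // !inE eqxx ?orbT.
by rewrite !inE => /orP[/eqP->|/eqP->].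
Qed.

Lemma cdegE x y : cdeg x y = \sum_v ((x \in nbhd v) && (y \in nbhd v)).
Proof.
rewrite /cdeg -sum1_card big_mkcond; apply: eq_bigr => v _.
by rewrite in_setI nbhdC (nbhdC y); case: (_ && _).
Qed.

Lemma sum_cdeg :
  \sum_x \sum_(y | y != x) cdeg x y = \sum_(v : G) #|nbhd v| * #|nbhd v|.-1.
Proof.
rewrite -(sum_off_diagonal_pairs xpredT (fun v : G => nbhd v)).
by apply: eq_bigr => x _; apply: eq_bigr => y _; rewrite cdegE.
Qed.

Lemma sum_off_diagonal k : \sum_(x : G) \sum_(y | y != x) k = #|G| * (#|G|.-1 * k).
Proof.
rewrite -sum_nat_const; apply: eq_bigr => x _; rewrite sum_nat_const; congr (_ * _).
by rewrite -(cardC1 x).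
Qed.

(** Twins may be adjacent or not, so the notion is invariant under complementation. Pairs are
    ordered. *)
Definition twin (pq : G * G) :=
  (pq.1 != pq.2) &&
  [forall w, (w != pq.1) ==> (w != pq.2) ==>
     ((w \in nbhd pq.1) == (w \in nbhd pq.2))].

Lemma twinP p q w : twin (p, q) -> w != p -> w != q -> (w \in nbhd p) = (w \in nbhd q).
Proof. by move=> /andP[_ /forallP/(_ w)] /= h wp wq; move: h; rewrite wp wq => /eqP. Qed.

Hypothesis cGc : sg_connected (sg_compl G).
Hypothesis gc3 : 2 < gammaP (sg_compl G).

Lemma cdeg_ge2 x y : 2 <= cdeg x y.
Proof.
rewrite /cdeg -cnbr2; apply: cnbr_gt1 => //.
  by rewrite cards2; case: eqP => _; lia.
by apply/set0Pn; exists x; rewrite !inE eqxx.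
Qed.

(* In the complement, [[set x; y]] observes everything but the common
   neighbours [p] and [q], so nobody may tell these two apart. *)
Lemma cdeg2_twin x y p q : nbhd x :&: nbhd y = [set p; q] -> p != q -> twin (p, q).
Proof.
move=> eU pq; rewrite /twin pq /=; apply/forallP => w; apply/implyP => wp; apply/implyP => wq.
set U := [set p; q] in eU; apply: contraT => neq.
have : @power_dominating (sg_compl G) [set x; y].
  apply/power_dominatingP => A TA stA.
  have UA z : z \notin A -> z \in U.
    move=> zA; rewrite -eU -cnbr2 cnbrE in_setC; apply: contra zA; exact/subsetP.
  have wA : w \in A by apply: contraT => /UA; rewrite !inE (negbTE wp) (negbTE wq).
  (* In the complement [w] sees [r] but not [s], so it forces [r]; then [s] is the only vertex
     left. *)
  have force r s : U = [set r; s] -> w \in nbhd s -> w \notin nbhd r -> w != r -> A = setT.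
    move=> Urs; rewrite nbhdC => ws; rewrite nbhdC => wr wnr; have rA : r \in A.
      suff /subsetP/(_ r) : @nbhd (sg_compl G) w \subset A.
        by apply; rewrite in_nbhd_compl wnr.
      apply: (@stalled_sub (sg_compl G) A w r stA wA); apply/subsetP => z.
      rewrite in_setD1 in_nbhd_compl => /and3P[zr _ zw].
      apply: contraT => /UA; rewrite Urs !inE (negbTE zr) /= => /eqP zs.
      by case/negP: zw; rewrite zs.
    apply: (@stalled_all_but_one (sg_compl G) A s) => //; first by apply/set0Pn; exists w.
    apply/subsetP => z; rewrite !inE => zA; have := UA z zA.
    rewrite Urs !inE => /orP[/eqP zr|//]; by rewrite -zr (negbTE zA) in rA.
  move: neq; have [wNp|wNp] := boolP (w \in nbhd p);
    have [wNq|wNq] := boolP (w \in nbhd q) => //= _.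
    by apply: (force q p) => //; rewrite /U setUC.
  exact: (force p q).
move=> /gammaP_le; rewrite cards2; case: eqP => _; lia.
Qed.

(** A codegree of 2 is made up for by the twin pair of the two common neighbours. *)
Lemma cdeg_twin_ge3 x y :
  3 <= cdeg x y + \sum_(pq | twin pq)
         ((x \in nbhd pq.1 :&: nbhd pq.2) && (y \in nbhd pq.1 :&: nbhd pq.2)).
Proof.
have := cdeg_ge2 x y; rewrite leq_eqVlt => /orP[/eqP/esym e|]; last by lia.
have /cards2P [p [q [pq eU]]] : #|nbhd x :&: nbhd y| == 2 by apply/eqP.
have tpq := cdeg2_twin eU pq.
have pN : p \in nbhd x :&: nbhd y by rewrite eU !inE eqxx.
have qN : q \in nbhd x :&: nbhd y by rewrite eU !inE eqxx orbT.
move: pN qN; rewrite !in_setI ![_ \in nbhd x]nbhdC ![_ \in nbhd y]nbhdC.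
move=> /andP[xp yp] /andP[xq yq].
by rewrite (bigD1 (p, q)) //= !in_setI xp yp xq yq e.
Qed.

Lemma sum_twins :
  #|G| * (#|G|.-1 * 3) <=
  \sum_(v : G) #|nbhd v| * #|nbhd v|.-1 +
  \sum_(pq | twin pq) cdeg pq.1 pq.2 * (cdeg pq.1 pq.2).-1.
Proof.
rewrite -sum_cdeg -sum_off_diagonal.
rewrite -(sum_off_diagonal_pairs twin (fun pq : G * G => nbhd pq.1 :&: nbhd pq.2)).
rewrite -big_split; apply: leq_sum => x _; rewrite -big_split; apply: leq_sum => y _.
exact: cdeg_twin_ge3.
Qed.

End Codegree.

Lemma twin_compl (G : sgraph) : @twin (sg_compl G) =1 @twin G.
Proof.
move=> [p q]; rewrite /twin /=; case: eqVneq => //= pq; apply: (@eq_forallb G) => w.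
case: eqVneq => //= wp; case: eqVneq => //= wq.
rewrite (@in_nbhd_compl G p w) (@in_nbhd_compl G q w) ![_ == w]eq_sym wp wq /=.
exact: (inj_eq negb_inj).
Qed.

(** Each vertex other than [p] and [q] is adjacent to both or to neither, so it is a common
    neighbour in exactly one of the two graphs. *)
Lemma cdeg_twin_compl (G : sgraph) (p q : G) :
  twin (p, q) -> cdeg p q + @cdeg (sg_compl G) p q = #|G| - 2.
Proof.
move=> t; have pq : p != q by case/andP: t.
have -> : @cdeg (sg_compl G) p q = #|~: (nbhd p :&: nbhd q) :\: [set p; q]|.
  apply: eq_card => w; rewrite (in_setI (T := sg_compl G)).
  rewrite (@in_nbhd_compl G p w) (@in_nbhd_compl G q w).
  rewrite in_setD in_set2 in_setC (in_setI (T := G)) ![_ == w]eq_sym negb_or.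
  case: eqVneq => //= wp; case: eqVneq => //= wq; first by rewrite andbF.
  by rewrite (twinP t wp wq) !andbb.
have e1 := cardsC (nbhd p :&: nbhd q).
have := cardsID [set p; q] (~: (nbhd p :&: nbhd q)).
rewrite (setIidPr _) ?cards2 ?pq /cdeg; first by lia.
apply/subsetP => z; rewrite !inE => /orP[/eqP->|/eqP->];
  by rewrite sedge_irrefl ?andbF.
Qed.

(** * Both power domination numbers at least three *)

Lemma degree_ge (G : sgraph) (v : G) a b :
  sg_connected G -> sg_connected (sg_compl G) ->
  gammaP G = a -> gammaP (sg_compl G) = b -> 1 < b ->
  a.-1 * (b - 2) + 2 <= #|nbhd v|.
Proof.
move=> cG cGc ea eb b1.
have := @codegree_ge (sg_compl G) v b a cGc (sg_connected_compl_compl cG) eb.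
by rewrite gammaP_compl_compl nbhd_compl_compl => /(_ ea b1).
Qed.

(* Any two vertices then have at least two common neighbours, in [G] and in its
   complement. Counting them settles n <= 10. For n = 11 it leaves at most four
   (ordered) pairs of twins, too few for all the pairs of vertices with exactly
   two common neighbours. *)
Lemma gammaP33_order (G : sgraph) :
  sg_connected G -> sg_connected (sg_compl G) ->
  gammaP G = 3 -> gammaP (sg_compl G) = 3 -> 11 < #|G|.
Proof.
move=> cG cGc ea eb; rewrite ltnNge; apply/negP => n11.
have cGcc := sg_connected_compl_compl cG.
have gc3 : 2 < gammaP (sg_compl G) by rewrite eb.
have gcc3 : 2 < gammaP (sg_compl (sg_compl G)) by rewrite gammaP_compl_compl ea.
have dsum (v : G) := card_nbhd_compl v.
have dge (v : G) : 4 <= #|nbhd v| by have := degree_ge v cG cGc ea eb isT.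
have dcge (v : G) : 4 <= #|@nbhd (sg_compl G) v| by have := codegree_ge v cG cGc ea eb isT.
have cge (x y : G) : 2 <= cdeg x y by exact: cdeg_ge2.
have ccge (x y : G) : 2 <= @cdeg (sg_compl G) x y by exact: cdeg_ge2.
pose D := \sum_(v : G) (#|nbhd v| * #|nbhd v|.-1 +
                  #|@nbhd (sg_compl G) v| * #|@nbhd (sg_compl G) v|.-1).
have sumD : \sum_(x : G) \sum_(y | y != x) (cdeg x y + @cdeg (sg_compl G) x y) = D.
  rewrite /D big_split -(sum_cdeg G) -(sum_cdeg (sg_compl G)) -big_split.
  by apply: eq_bigr => x _; rewrite -big_split.
have Dge : #|G| * (#|G|.-1 * 4) <= D.
  rewrite -sumD -sum_off_diagonal; apply: leq_sum => x _; apply: leq_sum => y _.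
  exact: leq_add (cge x y) (ccge x y).
have Dle k : (forall v : G, #|nbhd v| * #|nbhd v|.-1 +
    #|@nbhd (sg_compl G) v| * #|@nbhd (sg_compl G) v|.-1 <= k) -> D <= #|G| * k.
  by move=> h; rewrite -sum_nat_const; apply: leq_sum => v _.
have [v0 _] : exists v : G, v \in [set: G].
  by have /card_gt0P [x] := sgraph_nonempty G; exists x; rewrite inE.
have n9 : 9 <= #|G| by have := dsum v0; have := dge v0; have := dcge v0; lia.
(* Degrees in the two graphs are at least 4 and add up to n - 1. For n = 10 they are 4 and 5, and 12
   + 20 < 9 * 4; for n = 9 both are 4, and 12 + 12 < 8 * 4. *)
have n11' : #|G| = 11.
  have /or3P[/eqP//|/eqP n10|/eqP n9'] : [|| #|G| == 11, #|G| == 10 | #|G| == 9] by lia.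
    have := Dle 32; suff h : forall v : G, #|nbhd v| * #|nbhd v|.-1 +
      #|@nbhd (sg_compl G) v| * #|@nbhd (sg_compl G) v|.-1 <= 32 by move=> /(_ h); lia.
    move=> v; have := dsum v; have := dge v; have := dcge v; rewrite n10.
    by move: #|_| #|_| => [|[|[|[|[|[|d]]]]]] [|[|[|[|[|[|d']]]]]] //=; lia.
  have := Dle 24; suff h : forall v : G, #|nbhd v| * #|nbhd v|.-1 +
      #|@nbhd (sg_compl G) v| * #|@nbhd (sg_compl G) v|.-1 <= 24 by move=> /(_ h); lia.
  move=> v; have := dsum v; have := dge v; have := dcge v; rewrite n9'.
  by move: #|_| #|_| => [|[|[|[|[|d]]]]] [|[|[|[|[|d']]]]] //=; lia.
(* The extreme degrees are 4 and 6, with 12 + 30 = 42. *)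
have D462 : D <= 11 * 42.
  rewrite -n11'; apply: Dle => v; have := dsum v; have := dge v; have := dcge v.
  rewrite n11'; by move: #|_| #|_| => [|[|[|[|[|[|[|d]]]]]]] [|[|[|[|[|[|[|d']]]]]]] //=; lia.
pose tau := \sum_(x : G) \sum_(y | y != x) (twin (x, y) : nat).
(* Codegrees of twins add up to 9, which exceeds the general bound 4 by 5. Hence [tau] is at most
   4. *)
have tau4 : 11 * (10 * 4) + 5 * tau <= D.
  have <- : #|G| * (#|G|.-1 * 4) = 11 * (10 * 4) by rewrite n11'.
  rewrite -sumD -sum_off_diagonal big_distrr -big_split; apply: leq_sum => x _.
  rewrite big_distrr -big_split; apply: leq_sum => y _ /=.
  have := cge x y; have := ccge x y; case t: (twin (x, y)) => /=; last by lia.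
  by have := cdeg_twin_compl t; rewrite n11'; lia.
have tauE : tau = \sum_(pq : G * G | twin pq) 1.
  rewrite /tau [RHS]big_mkcond (pair_big_dep xpredT (fun x y => y != x)) /=.
  rewrite big_mkcond; apply: eq_bigr => -[x y] _ /=.
  case t: (twin (x, y)); last by case: ifP.
  by have /andP[/= xy _] := t; rewrite eq_sym xy.
have s1 := sum_twins cGc gc3.
have s2 : #|G| * (#|G|.-1 * 3) <=
    \sum_(v : G) #|@nbhd (sg_compl G) v| * #|@nbhd (sg_compl G) v|.-1 +
    \sum_(pq : G * G | @twin (sg_compl G) pq) @cdeg (sg_compl G) pq.1 pq.2 *
       (@cdeg (sg_compl G) pq.1 pq.2).-1 := sum_twins cGcc gcc3.
(* Two codegrees of at least 2 with sum 9 are at the extreme 7 and 2, with 42 + 2 = 44. *)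
have s3 : \sum_(pq : G * G | twin pq) cdeg pq.1 pq.2 * (cdeg pq.1 pq.2).-1 +
  \sum_(pq : G * G | @twin (sg_compl G) pq) @cdeg (sg_compl G) pq.1 pq.2 *
     (@cdeg (sg_compl G) pq.1 pq.2).-1 <= 44 * tau.
  rewrite (eq_bigl _ _ (@twin_compl G)) -big_split tauE big_distrr.
  apply: leq_sum => -[p q] t; have := cdeg_twin_compl t.
  rewrite n11' /=; have := cge p q; have := ccge p q.
  by move: (cdeg p q) (cdeg _ _) => [|[|[|[|[|[|[|[|c]]]]]]]] [|[|[|[|[|[|[|[|c']]]]]]]] //=; lia.
(* Adding [s1] and [s2] gives 660 <= 462 + 44 * 4 = 638. *)
move: D462 tau4 s1 s2 s3; rewrite /D big_split n11' /=.
by lia.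
Qed.

(* Double counting, over all [w], of the vertices that [w] observes among the
   ones not observed by [v]. *)
Lemma two_step_count (G : sgraph) (v : G) a d :
  sg_connected G -> sg_connected (sg_compl G) ->
  gammaP G = a -> 2 < gammaP (sg_compl G) -> 3 <= a ->
  (forall u : G, d <= #|nbhd u|) ->
  #|G| * (2 * a - 4) + #|~: cnbhd v| * d.+1 <= #|G| * #|~: cnbhd v|.
Proof.
move=> cG cGc ea gc a3 dd; set R := ~: cnbhd v.
(* [v] and [w] together leave at least 2 * (a - 3) + 2 vertices undominated. *)
have step w : 2 * a - 4 + #|R :&: cnbhd w| <= #|R|.
  have e : ~: cnbhds [set v; w] = R :\: cnbhd w.
    by rewrite /cnbhds bigcup_setU !big_set1 setCU setDE.
  have := @gammaP_greedy G 2 [set v; w] (a - 3) cG cGc gc.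
  have := cardsID (cnbhd w) R; rewrite e => e1 h.
  have : 2 * (a - 3) + 2 <= #|R :\: cnbhd w|.
    by apply: h; [apply/set0Pn; exists v; rewrite !inE eqxx | rewrite cards2; case: eqP; lia].
  by lia.
have lower : #|R| * d.+1 <= \sum_w #|R :&: cnbhd w|.
  have -> : \sum_w #|R :&: cnbhd w| = \sum_(x in R) #|cnbhd x|.
    rewrite [RHS]big_mkcond.
    transitivity (\sum_(w : G) \sum_(x : G) ((x \in R) && (x \in cnbhd w))).
      apply: eq_bigr => w _; rewrite -sum1_card big_mkcond; apply: eq_bigr => x _.
      by rewrite in_setI; case: (_ && _).
    rewrite exchange_big; apply: eq_bigr => x _; case: (x \in R) => /=; last by rewrite big1.
    rewrite -sum1_card [RHS]big_mkcond; apply: eq_bigr => w _.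
    by rewrite !cnbhdE eq_sym nbhdC; case: (_ || _).
  by rewrite -sum_nat_const; apply: leq_sum => x _; rewrite card_cnbhd ltnS.
apply: (@leq_trans (\sum_(w : G) (2 * a - 4 + #|R :&: cnbhd w|))).
  by rewrite big_split /= sum_nat_const leq_add2l.
by rewrite -sum_nat_const; apply: leq_sum => w _.
Qed.

Lemma bound_both_ge3 (G : sgraph) :
  sg_connected G -> sg_connected (sg_compl G) ->
  3 <= gammaP (sg_compl G) <= gammaP G ->
  #|G| \notin [:: 12; 13; 14; 15; 16; 17; 18; 20; 21; 24] ->
  gammaP G + gammaP (sg_compl G) <= (#|G| + 2) %/ 3 + 1.
Proof.
move=> cG cGc; set a := gammaP G; set b := gammaP (sg_compl G) => /andP[b3 ba] nE.
have [v _] : exists v : G, v \in [set: G].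
  by have /card_gt0P [x] := sgraph_nonempty G; exists x; rewrite inE.
have d1 (u : G) : a.-1 * (b - 2) + 2 <= #|nbhd u| by apply: degree_ge => //; lia.
have d2 : b.-1 * (a - 2) + 2 <= #|@nbhd (sg_compl G) v| by apply: codegree_ge => //; lia.
have sum := card_nbhd_compl v.
have d1v := d1 v.
have [b4|b4] := leqP 4 b.
  have [a5|a4] := leqP 5 a.
    (* The sum of the two degree bounds, plus 1 for [v] itself. *)
    have : 2 * (a * b) + 9 <= #|G| + 3 * (a + b) by nia.
    have : 3 * (a + b) + 1 <= 2 * (a * b) + 9 + 3 - 3 * (a + b) + 3 by nia.
    by lia.
  have ea : a = 4 by lia.
  have eb : b = 4 by lia.
  (* Here n >= 17, and the claim needs n >= 19. *)
  by rewrite ea eb in d1v d2 *; move: nE; rewrite !inE; lia.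
have eb : b = 3 by lia.
rewrite eb in d1v d2 d1 *.
have [ea|a4] : a = 3 \/ 4 <= a by lia.
  have := gammaP33_order cG cGc ea eb; rewrite ea.
  by move: nE; rewrite !inE; lia.
have d1' (u : G) : a.+1 <= #|nbhd u| by have := d1 u; lia.
have count := two_step_count v cG cGc (erefl a) b3 (leq_trans b3 ba) d1'.
have r := cardsC (cnbhd v); rewrite card_cnbhd in r.
have [a6|a7] := leqP a 6.
  (* The degree bounds give n >= 3a, and the claim needs n >= 16, 19, 22 respectively. Excluded
     orders fill the gap, except for n = 19 when a = 6, which [count] rules out. *)
  have [e|[e|e]] : a = 4 \/ a = 5 \/ a = 6 by lia.
  - by rewrite e in d1v d2 *; move: nE; rewrite !inE; lia.
  - by rewrite e in d1v d2 *; move: nE; rewrite !inE; lia.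
  - by rewrite e in d1v d2 count *; move: nE; rewrite !inE; nia.
have n3 : 3 * a <= #|G| by lia.
(* Failure means 3a <= n <= 3a + 3, but [count] then gives n(2a - 4) <= (n - a - 2)^2, impossible
   for a >= 7. *)
rewrite leqNgt; apply/negP => lt.
have n3' : #|G| <= 3 * a + 3 by lia.
have rle : #|~: cnbhd v| + a + 2 <= #|G| by lia.
nia.
Qed.

(** * The bound and its sharpness *)

Lemma gammaP_compl_sum_le (G : sgraph) :
  sg_connected G -> sg_connected (sg_compl G) ->
  #|G| \notin [:: 12; 13; 14; 15; 16; 17; 18; 20; 21; 24] ->
  gammaP G + gammaP (sg_compl G) <= (#|G| + 2) %/ 3 + 1.
Proof.
wlog le : G / gammaP (sg_compl G) <= gammaP G => [wl|] cG cGc nE.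
  have [|/ltnW lt] := leqP (gammaP (sg_compl G)) (gammaP G); first by move=> le; apply: wl.
  rewrite addnC -{1}(gammaP_compl_compl G); apply: (wl (sg_compl G)) => //.
    by rewrite gammaP_compl_compl.
  exact: sg_connected_compl_compl.
have n0 := sgraph_nonempty G.
have b0 := gammaP_gt0 (sg_compl G).
have [b3|b2] := leqP 3 (gammaP (sg_compl G)).
  by apply: bound_both_ge3 => //; rewrite b3.
have [a2|a1] := leqP 2 (gammaP G); last by lia.
have [] := gammaP_third cG a2; have := @gammaP_third_lt G cG cGc a2.
by have [|] := leqP 2 (gammaP (sg_compl G)); lia.
Qed.

Import Num.Theory GRing.Theory.

Lemma ceil_div3 (n : nat) :
  Num.ceil (n%:R / 3%:R : rat)%R = Posz ((n + 2) %/ 3).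
Proof.
case: n => [|n]; first by rewrite mul0r ceil0.
have [j ej] : exists j, ((n.+1 + 2) %/ 3)%N = j.+1 by exists ((n %/ 3)%N); lia.
have up : (Num.ceil (n.+1%:R / 3%:R : rat)%R <= Posz j.+1)%R.
  by rewrite ceil_le_int ler_pdivrMr // -natrM ler_nat; lia.
have lo : (Posz j < Num.ceil (n.+1%:R / 3%:R : rat)%R)%R.
  by rewrite ceil_gt_int ltr_pdivlMr // -natrM ltr_nat; lia.
by rewrite ej; lia.
Qed.

(** * Graphs attaining the bound *)

Section Complete.
Variable m : nat.

Definition complete_edge : rel 'I_m.+1 := fun x y => x != y.

Lemma complete_edge_sym : symmetric complete_edge.
Proof. by move=> x y; rewrite /complete_edge eq_sym. Qed.

Lemma complete_edge_irrefl : irreflexive complete_edge.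
Proof. by move=> x; rewrite /complete_edge eqxx. Qed.

Lemma complete_nonempty : 0 < #|'I_m.+1|.
Proof. by rewrite card_ord. Qed.

Definition complete_graph : sgraph :=
  SGraph complete_edge_sym complete_edge_irrefl complete_nonempty.

Lemma complete_connected : sg_connected complete_graph.
Proof.
move=> x y; have [->|xy] := eqVneq x y; first exact: connect0.
exact: connect1.
Qed.
End Complete.

Section Pendant.
Variables (H : sgraph) (p : pred H).
Let G := pendant_graph p.

Lemma card_pendant : #|G| = 3 * #|H|.
Proof. by rewrite card_sum card_prod card_bool; lia. Qed.

Lemma pendant_connected : sg_connected H -> sg_connected G.
Proof.
move=> cH.
have cl u v : @connect G (@sedge G) (inl u) (inl v).
  have /connectP [q + ->] := cH u v; elim: q u => [|w q IH] u /=; first by rewrite connect0.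
  by move=> /andP[uw qw]; apply: connect_trans (connect1 _) (IH w qw).
have toH x : exists u, @connect G (@sedge G) x (inl u) /\ @connect G (@sedge G) (inl u) x.
  case: x => [u|[u i]]; exists u; split; rewrite ?connect0 //.
    by apply: connect1; rewrite /= eqxx.
  by apply: connect1; rewrite /= eqxx.
move=> x y; have [u [xu _]] := toH x; have [v [_ vy]] := toH y.
exact: connect_trans (connect_trans xu (cl u v)) vy.
Qed.

(** In the complement a new vertex is adjacent to everything attached to other vertices of [H]. So
    every vertex is joined to some [a w], and these are pairwise adjacent. *)
Lemma pendant_compl_connected : 1 < #|H| -> sg_connected (sg_compl G).
Proof.
move=> /card_gt1P [u [v [_ _ uv]]].
pose e := @sedge (sg_compl G).
have csym : connect_sym e by apply/sym_connect_sym/(@sedge_sym (sg_compl G)).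
pose a (w : H) : G := inr (w, true).
have tocross (w w' : H) i j : w != w' -> connect e (inr (w, i)) (inr (w', j)).
  move=> ww; apply: connect1; rewrite /e /= /compl_edge /= (negbTE ww) /= andbT.
  by apply: contra ww => /eqP[->].
have tol (w w' : H) i : w != w' -> connect e (inr (w, i)) (inl w').
  by move=> ww; apply: connect1; rewrite /e /= /compl_edge /= (negbTE ww).
have other (w : H) : exists w', w' != w.
  by have [<-|] := eqVneq u w; [exists v; rewrite eq_sym | exists u].
have toa x : exists w, connect e x (a w).
  case: x => [w|[w i]]; have [w' ww] := other w; exists w'.
    by rewrite csym tol.
  by apply: tocross; rewrite eq_sym.
have aa w w' : connect e (a w) (a w').
  have [->|ww] := eqVneq w w'; first exact: connect0.
  exact: tocross.
move=> x y; have [w xw] := toa x; have [w' yw] := toa y.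
by apply: connect_trans xw (connect_trans (aa w w') _); rewrite csym.
Qed.

(* A set avoiding [v], [v'] and [v''] never observes [v'] and [v'']. *)
Lemma pendant_gammaP_ge : #|H| <= gammaP G.
Proof.
have [S pS <-] := gammaP_witness G.
pose f (x : G) : H := match x with inl u => u | inr (u, _) => u end.
suff fS : [set: H] \subset f @: S.
  by rewrite -cardsT; apply: leq_trans (subset_leq_card fS) (leq_imset_card _ _).
apply/subsetP => v _; apply: contraT => vS.
have notS x : x \in S -> f x != v.
  by move=> xS; apply: contraNneq vS => <-; apply: imset_f.
(* This set is stalled: [v] has two neighbours outside it, every other member none. *)
pose A : {set G} := ~: [set inr (v, true); inr (v, false)].
have : inr (v, true) \in A.
  have /power_dominatingP h := pS; rewrite (h A) ?inE //.
    apply/subsetP => y /cnbhdsP [x xS]; rewrite !inE => xy.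
    apply: contraL xy => yv; rewrite negb_or; have := notS x xS.
    case/orP: yv => /eqP->; case: x {xS} => [u|[u i]] /= uv.
    - by rewrite uv.
    - by rewrite (negbTE uv) andbT; apply: contra uv => /eqP[->].
    - by rewrite uv.
    - by rewrite (negbTE uv) andbT; apply: contra uv => /eqP[->].
  move=> x; rewrite !inE => xA; rewrite setDE setCK.
  have [->|xv] := eqVneq x (inl v).
    suff -> : nbhd (inl v : G) :&: [set inr (v, true); inr (v, false)] =
              [set inr (v, true); inr (v, false)].
      by rewrite cards2; case: (inr (v, true) =P inr (v, false)) => // -[].
    by apply/setIidPr/subsetP => y; rewrite !inE => /orP[] /eqP->/=.
  rewrite (_ : _ :&: _ = set0) ?cards0 //; apply/setP => y; rewrite !inE.
  apply/negP => /andP[xy yv]; case/orP: yv xy => /eqP->;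
    case: x xA xv => [u|[u []]] /=; rewrite ?andbF //.
  - by move=> _ uv /eqP e; rewrite e eqxx in uv.
  - by move=> uN _ /andP[/eqP e _]; rewrite e eqxx orbT in uN.
  - by move=> _ uv /eqP e; rewrite e eqxx in uv.
  - by move=> uN _ /andP[/eqP e _]; rewrite e eqxx in uN.
by rewrite !inE eqxx.
Qed.
End Pendant.

Theorem theorem3p4 :
  (forall G : sgraph,
     sg_connected G -> sg_connected (sg_compl G) ->
     #|G| \notin [:: 12; 13; 14; 15; 16; 17; 18; 20; 21; 24] ->
     (Posz (gammaP G + gammaP (sg_compl G))
        <= Num.ceil (#|G|%:R / 3%:R : rat) + 1)%R)
  /\
  (forall N : nat, exists G : sgraph,
     [/\ family_T G, N <= #|G| & 6 <= #|G|] /\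
     [/\ sg_connected G, sg_connected (sg_compl G),
         #|G| \notin [:: 12; 13; 14; 15; 16; 17; 18; 20; 21; 24] &
         Posz (gammaP G + gammaP (sg_compl G))
           = (Num.ceil (#|G|%:R / 3%:R : rat) + 1)%R]).
Proof.
split=> [G cG cGc nE|N].
  by rewrite ceil_div3; have := gammaP_compl_sum_le cG cGc nE; lia.
(* [H] has N + 9 vertices, so the order 3(N + 9) exceeds all excluded values. *)
pose H := complete_graph (N + 8); have cardH : #|H| = (N + 8).+1 by exact: card_ord.
pose G := pendant_graph (pred0 : pred H).
have cardG : #|G| = 3 * (N + 9) by rewrite card_pendant cardH; lia.
have cG : sg_connected G by apply/pendant_connected/complete_connected.
have cGc : sg_connected (sg_compl G).
  by apply: pendant_compl_connected; rewrite cardH; lia.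
have nE : #|G| \notin [:: 12; 13; 14; 15; 16; 17; 18; 20; 21; 24].
  by rewrite cardG !inE; lia.
exists G; split; split=> //; try by rewrite cardG; lia.
  exists H, (pred0 : pred H); split; first exact: complete_connected.
  by exists id; split=> //; exists id.
rewrite ceil_div3.
(* The lower bounds N + 9 and 1 add up to the upper bound. *)
have := pendant_gammaP_ge (pred0 : pred H); have := gammaP_gt0 (sg_compl G).
have := gammaP_compl_sum_le cG cGc nE; rewrite -/G cardH cardG; lia.
Qed.
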